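(* Let $t,s,d$ be positive integers with $s\ge t$, and put $m=ts$, $n=sd$. Let $P_C$ be an integer with $0\le P_C<P$, and put $\Delta'_{P_C}=\left\lceil \frac{P_C}{\min\{t,d\}}\right\rceil$ and $s^*=s+\Delta'_{P_C}$. Define $$P_R=t\,(s^*d-\Delta'_{P_C})+ts+2P_C-1,$$ and assume $P_R\le P$. Then the secure generalized PolyDot (SGPD) code for the case $s\ge t$ (defined in the context) is feasible with security level $P_C$ and recovery threshold $P_R$, and it has communication load $C_L=P_R\,\frac{TD}{td}$. That is: (security) $I(\mathbf A_{\mathcal P},\mathbf B_{\mathcal P};\mathbf A,\mathbf B)=0$ for every $\mathcal P\subset\{1,\dots,P\}$ with $|\mathcal P|=P_C$; (decodability) $H(\mathbf A\mathbf B\mid\{\mathbf C_p\}_{p\in\mathcal P_R})=0$ for every $\mathcal P_R\subset\{1,\dots,P\}$ with $|\mathcal P_R|=P_R$; and (load) $\sum_{p\in\mathcal P_R}|\mathbf C_p|=P_R\,\frac{TD}{td}$ for every such $\mathcal P_R$.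
   Context: Secure distributed matrix multiplication. $\mathbb F$ is a finite field and $P$ is the number of workers, with $|\mathbb F|>P$. $\mathbf A\in\mathbb F^{T\times S}$ and $\mathbf B\in\mathbb F^{S\times D}$ are independent random matrices with i.i.d. entries uniform on $\mathbb F$. The integers satisfy $t\mid T$, $s\mid S$, $d\mid D$. A master sends to worker $p\in\{1,\dots,P\}$ an encoded matrix $\mathbf A_p\in\mathbb F^{T/t\times S/s}$, a function of $\mathbf A$ and of random matrices independent of the data, and an encoded matrix $\mathbf B_p\in\mathbb F^{S/s\times D/d}$, a function of $\mathbf B$ and of independent random matrices. Worker $p$ returns $\mathbf C_p=\mathbf A_p\mathbf B_p\in\mathbb F^{T/t\times D/d}$, and the master must recover $\mathbf A\mathbf B$ from the outputs of $P_R$ workers. For a set $\mathcal P$ of workers, $\mathbf A_{\mathcal P}=\{\mathbf A_p\}_{p\in\mathcal P}$ and $\mathbf B_{\mathcal P}=\{\mathbf B_p\}_{p\in\mathcal P}$. $H$ is entropy, $I$ is mutual information, and $|\mathbf C_p|$ is the number of entries of $\mathbf C_p$. The communication load is $C_L=\sum_{p\in\mathcal P_R}|\mathbf C_p|$. SGPD code, case $s\ge t$. Partition $\mathbf A$ into $t\times s$ blocks $\mathbf A_{i,j}\in\mathbb F^{T/t\times S/s}$ ($1\le i\le t$, $1\le j\le s$) and $\mathbf B$ into $s\times d$ blocks $\mathbf B_{k,l}\in\mathbb F^{S/s\times D/d}$ ($1\le k\le s$, $1\le l\le d$). Let $\mathbf R_0,\dots,\mathbf R_{P_C-1}\in\mathbb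 F^{T/t\times S/s}$ and $\mathbf R'_0,\dots,\mathbf R'_{P_C-1}\in\mathbb F^{S/s\times D/d}$ be random matrices with i.i.d. uniform entries in $\mathbb F$, mutually independent and independent of $(\mathbf A,\mathbf B)$. With $\Delta'_{P_C}=\lceil P_C/\min\{t,d\}\rceil$ and $s^*=s+\Delta'_{P_C}$, define the matrix polynomials $$\mathbf F_{\mathbf a^*}(z)=\sum_{i=1}^t\sum_{j=1}^s\mathbf A_{i,j}z^{i-1+t(j-1)}+\sum_{r=0}^{P_C-1}\mathbf R_r z^{ts+r},$$ $$\mathbf F_{\mathbf b^*}(z)=\sum_{k=1}^s\sum_{l=1}^d\mathbf B_{k,l}z^{(s-k)t+ts^*(l-1)}+\sum_{r=0}^{P_C-1}\mathbf R'_r z^{t(s^*d-\Delta'_{P_C})+r}.$$ Fix distinct non-zero points $z_1,\dots,z_P\in\mathbb F$. The code sets $\mathbf A_p=\mathbf F_{\mathbf a^*}(z_p)$ and $\mathbf B_p=\mathbf F_{\mathbf b^*}(z_p)$ for $p=1,\dots,P$. *)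

(* Defs.v *)
From HB Require Import structures.
From mathcomp Require Import all_boot all_order all_algebra.
From mathcomp Require Import all_classical all_reals all_analysis.

Set Implicit Arguments.
Unset Strict Implicit.
Unset Printing Implicit Defensive.

Import Order.TTheory GRing.Theory Num.Theory.

Local Open Scope classical_set_scope.
Local Open Scope ring_scope.

Section RandomVariables.
Context {R : realType} {disp : measure_display} {Om : measurableType disp}.
Variable Pr : probability Om R.

(* A random variable with values in a finite set, the latter being equipped
   with its discrete sigma-algebra. *)
Definition finite_rv (V : finType) (X : Om -> V) : Prop :=
  forall E : set V, measurable (X @^-1` E).

(* The sigma-algebra generated by X. *)
Definition rv_events (V : finType) (X : Om -> V) : set (set Om) :=
  [set X @^-1` E | E in [set: set V]].

(* Classes of events instead of random variables, so that the members of the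
   family may take their values in different types. *)
Definition mutually_independent (I : finType) (G : I -> set (set Om)) : Prop :=
  forall (J : {set I}) (E : I -> set Om),
    (forall i, i \in J -> G i (E i)) ->
    fine (Pr (\bigcap_(i in [set` J]) E i)) = \prod_(i in J) fine (Pr (E i)).

Definition independent2 (U V : finType) (X : Om -> U) (Y : Om -> V) : Prop :=
  forall (E : set U) (E' : set V),
    fine (Pr (X @^-1` E `&` Y @^-1` E')) =
    fine (Pr (X @^-1` E)) * fine (Pr (Y @^-1` E')).

Definition rv_pmf (V : finType) (X : Om -> V) (v : V) : R :=
  fine (Pr (X @^-1` [set v])).

Definition uniform_rv (V : finType) (X : Om -> V) : Prop :=
  forall v : V, rv_pmf X v = #|V|%:R^-1.

Definition rv_pair (U V : finType) (X : Om -> U) (Y : Om -> V) : Om -> U * V :=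
  fun w => (X w, Y w).

Definition rv_family (I V : finType) (X : I -> Om -> V) : Om -> {ffun I -> V} :=
  fun w => [ffun i => X i w].

Definition rv_subfamily (I V : finType) (J : {set I}) (X : I -> Om -> V) :
    Om -> {ffun {i : I | i \in J} -> V} :=
  rv_family (fun i : {i : I | i \in J} => X (val i)).

(* Information is measured in nats.  Terms of probability 0 contribute 0. *)
Definition cond_entropy (U V : finType) (X : Om -> U) (Y : Om -> V) : R :=
  - \sum_(u : U) \sum_(v : V)
      rv_pmf (rv_pair X Y) (u, v) *
      ln (rv_pmf (rv_pair X Y) (u, v) / rv_pmf Y v).

Definition mutual_info (U V : finType) (X : Om -> U) (Y : Om -> V) : R :=
  \sum_(u : U) \sum_(v : V)
     rv_pmf (rv_pair X Y) (u, v) *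
     ln (rv_pmf (rv_pair X Y) (u, v) / (rv_pmf X u * rv_pmf Y v)).

Definition iid_uniform_mx (F : finFieldType) (m n : nat)
    (X : Om -> 'M[F]_(m, n)) : Prop :=
  [/\ finite_rv X,
      mutually_independent
        (fun ij : 'I_m * 'I_n => rv_events (fun w => X w ij.1 ij.2)) &
      forall i j, uniform_rv (fun w => X w i j)].

End RandomVariables.

Section Blocks.

Lemma block_ord_subproof (t T : nat) (i : 'I_t) (u : 'I_(T %/ t)) :
  (i * (T %/ t) + u < T)%N.
Proof.
apply: (@leq_trans (t * (T %/ t))%N); last by rewrite mulnC leq_divM.
apply: (@leq_trans (i.+1 * (T %/ t))%N); last by rewrite leq_mul2r ltn_ord orbT.
by rewrite mulSn addnC ltn_add2r ltn_ord.
Qed.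

Definition block_ord (t T : nat) (i : 'I_t) (u : 'I_(T %/ t)) : 'I_T :=
  Ordinal (block_ord_subproof i u).

(* Block (i, j) of the partition of M into t x s blocks of equal size; t and s
   are meant to divide T and S. *)
Definition mx_block (F : Type) (T S t s : nat) (M : 'M[F]_(T, S))
    (i : 'I_t) (j : 'I_s) : 'M[F]_(T %/ t, S %/ s) :=
  mxsub (@block_ord t T i) (@block_ord s S j) M.

End Blocks.

Definition num_entries (F : Type) (m n : nat) (M : 'M[F]_(m, n)) : nat :=
  #|{: 'I_m * 'I_n}|.

(* The ceiling of a / b, for b > 0. *)
Definition ceil_div (a b : nat) : nat := ((a + b.-1) %/ b)%N.

Definition sgpd_delta (t d PC : nat) : nat := ceil_div PC (minn t d).

Definition sgpd_sstar (t s d PC : nat) : nat := (s + sgpd_delta t d PC)%N.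

(* None of the natural-number subtractions truncates when t, s, d > 0. *)
Definition sgpd_threshold (t s d PC : nat) : nat :=
  (t * (sgpd_sstar t s d PC * d - sgpd_delta t d PC) + t * s + 2 * PC - 1)%N.

Section SGPD.
Variables (F : finFieldType) (T S D t s d PC : nat).

(* Block indices start at 0 here: the exponents i - 1 + t (j - 1) and
   (s - k) t + t s^* (l - 1) of the 1-based description become i + t j and
   (s - k - 1) t + t s^* l. *)
Definition sgpd_Fa (A : 'M[F]_(T, S)) (Ra : 'I_PC -> 'M[F]_(T %/ t, S %/ s))
    (x : F) : 'M[F]_(T %/ t, S %/ s) :=
  \sum_(i < t) \sum_(j < s) x ^+ (i + t * j) *: mx_block A i j
  + \sum_(r < PC) x ^+ (t * s + r) *: Ra r.

Definition sgpd_Fb (B : 'M[F]_(S, D)) (Rb : 'I_PC -> 'M[F]_(S %/ s, D %/ d))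
    (x : F) : 'M[F]_(S %/ s, D %/ d) :=
  \sum_(k < s) \sum_(l < d)
     x ^+ ((s - k.+1) * t + t * sgpd_sstar t s d PC * l) *: mx_block B k l
  + \sum_(r < PC)
     x ^+ (t * (sgpd_sstar t s d PC * d - sgpd_delta t d PC) + r) *: Rb r.

Variables (Om : Type) (N : nat) (z : 'I_N -> F).
Variables (A : Om -> 'M[F]_(T, S)) (B : Om -> 'M[F]_(S, D)).
Variables (Ra : 'I_PC -> Om -> 'M[F]_(T %/ t, S %/ s)).
Variables (Rb : 'I_PC -> Om -> 'M[F]_(S %/ s, D %/ d)).

Definition sgpd_encA (p : 'I_N) (w : Om) : 'M[F]_(T %/ t, S %/ s) :=
  sgpd_Fa (A w) (Ra^~ w) (z p).

Definition sgpd_encB (p : 'I_N) (w : Om) : 'M[F]_(S %/ s, D %/ d) :=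
  sgpd_Fb (B w) (Rb^~ w) (z p).

Definition sgpd_out (p : 'I_N) (w : Om) : 'M[F]_(T %/ t, D %/ d) :=
  sgpd_encA p w *m sgpd_encB p w.

End SGPD.

Section Requirements.
Context {R : realType} {disp : measure_display} {Om : measurableType disp}.
Variables (Pr : probability Om R) (F : finFieldType) (N : nat).

Definition secure (T S D m k n : nat)
    (A : Om -> 'M[F]_(T, S)) (B : Om -> 'M[F]_(S, D))
    (Ap : 'I_N -> Om -> 'M[F]_(m, k)) (Bp : 'I_N -> Om -> 'M[F]_(k, n))
    (PC : nat) : Prop :=
  forall P : {set 'I_N}, #|P| = PC ->
    mutual_info Pr (rv_pair (rv_subfamily P Ap) (rv_subfamily P Bp))
                   (rv_pair A B) = 0.

Definition decodable (T S D m n : nat)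
    (A : Om -> 'M[F]_(T, S)) (B : Om -> 'M[F]_(S, D))
    (Cp : 'I_N -> Om -> 'M[F]_(m, n)) (PR : nat) : Prop :=
  forall P : {set 'I_N}, #|P| = PR ->
    cond_entropy Pr (fun w => A w *m B w) (rv_subfamily P Cp) = 0.

End Requirements.

Definition comm_load (F : Type) (N m n : nat) (P : {set 'I_N})
    (C : 'I_N -> 'M[F]_(m, n)) : nat :=
  (\sum_(p in P) num_entries (C p))%N.

(* Main.v *)
(* Decoding: the product of the two encoding polynomials has degree less than
   the recovery threshold, so its coefficients are determined by the outputs of
   that many workers.  The coefficient of exponent i + t (s - 1) + t s^* l is
   the block (i, l) of A B: in mixed radix (t, s^* ) only the products of data
   blocks A_(i,j) B_(j,l) land there, the bound PC <= t Delta keeping the terms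
   R_r B_(k,l') away from it.
   Security: on PC workers the masks enter through a Vandermonde matrix with
   rows scaled by nonzero factors, so for fixed data the shares are a bijective image
   of the uniform masks, as in a one-time pad. *)
Require Import Defs.
From HB Require Import structures.
From mathcomp Require Import all_boot all_order all_algebra.
From mathcomp Require Import all_classical all_reals all_analysis.
From mathcomp Require Import zify ring.

Set Implicit Arguments.
Unset Strict Implicit.
Unset Printing Implicit Defensive.

Import Order.TTheory GRing.Theory Num.Theory.

Local Open Scope classical_set_scope.
Local Open Scope ring_scope.

(** * Interpolation of matrix polynomials *)

Section MatrixPolynomials.
Variables (F : fieldType) (I : finType) (z : I -> F) (P : {set I}).
Hypothesis z_inj : injective z.

(** Entry by entry, the difference of the two sides is a polynomial of degree below [#|P|] with
    [#|P|] distinct roots, hence zero. Exponents may repeat, so only sums over a fibre of [g] are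
    determined. *)
Lemma coef_sum_eq (K : finType) (g : K -> nat) (m n : nat)
    (M M' : K -> 'M[F]_(m, n)) (e : nat) :
    (forall k, g k < #|P|)%N ->
    (forall p, p \in P ->
       \sum_k z p ^+ g k *: M k = \sum_k z p ^+ g k *: M' k) ->
  \sum_(k | g k == e) M k = \sum_(k | g k == e) M' k.
Proof.
move=> ltgP eqMM'; apply/matrixP=> u v; rewrite !summxE.
pose q := \sum_k (M k u v - M' k u v) *: 'X^(g k) : {poly F}.
have q0 : q = 0.
  apply: (@roots_geq_poly_eq0 _ _ [seq z p | p <- enum P]).
  - apply/allP=> x /mapP[p]; rewrite mem_enum => pP ->.
    have := congr1 (fun X : 'M[F]_(m, n) => X u v) (eqMM' p pP).
    rewrite !summxE => eq_uv; apply/rootP; rewrite horner_sum.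
    transitivity (\sum_k (z p ^+ g k *: M k) u v - \sum_k (z p ^+ g k *: M' k) u v).
      rewrite -sumrB; apply: eq_bigr => k _.
      by rewrite hornerZ hornerXn !mxE mulrC mulrBr.
    by rewrite eq_uv subrr.
  - by rewrite map_inj_uniq ?enum_uniq.
  - rewrite size_map -cardE; apply: (leq_trans (size_sum _ _ _)).
    apply/bigmax_leqP=> k _; apply: leq_trans (size_scale_leq _ _) _.
    by rewrite size_polyXn.
have /eqP := congr1 (fun r : {poly F} => r`_e) q0.
rewrite coef0 coef_sum.
under eq_bigr do rewrite coefZ coefXn eq_sym mulr_natr mulrb.
rewrite -big_mkcond /= sumrB subr_eq0.
by move/eqP.
Qed.

(** The factor [z p ^+ c] cancels at a non-zero point, which leaves the exponents 0 to N-1 on N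
    points, all with singleton fibres. *)
Lemma masks_inj (m n c N : nat) (Q Q' : 'I_N -> 'M[F]_(m, n)) :
    (forall p, z p != 0) -> #|P| = N ->
    (forall p, p \in P -> \sum_(r < N) z p ^+ (c + r) *: Q r =
                          \sum_(r < N) z p ^+ (c + r) *: Q' r) ->
  Q =1 Q'.
Proof.
move=> z_neq0 cardP eqQ r.
have := @coef_sum_eq 'I_N (@nat_of_ord _) m n Q Q' r.
rewrite !(big_pred1 r) ?cardP; last first.
  1,2: by move=> k; rewrite /= -val_eqE.
apply=> [|p pP]; first exact: ltn_ord.
have := eqQ p pP.
rewrite (eq_bigr (fun k : 'I_N => z p ^+ c *: (z p ^+ k *: Q k))); last first.
  by move=> k _; rewrite exprD scalerA.
rewrite [in RHS](eq_bigr (fun k : 'I_N => z p ^+ c *: (z p ^+ k *: Q' k))); last first.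
  by move=> k _; rewrite exprD scalerA.
by rewrite -!scaler_sumr => /(scalerI (expf_neq0 c (z_neq0 p))).
Qed.

End MatrixPolynomials.

(** * Entropy, mutual information and the one-time pad *)

Section Probability.
Context {R : realType} {disp : measure_display} {Om : measurableType disp}.
Variable Pr : probability Om R.

Lemma fine_prob_total (V : finType) (Y : Om -> V) (E : set Om) :
    measurable E -> (forall v, measurable (Y @^-1` [set v])) ->
  fine (Pr E) = \sum_v fine (Pr (E `&` Y @^-1` [set v])).
Proof.
move=> mE mY; have mEY v : measurable (E `&` Y @^-1` [set v]) by exact: measurableI.
rewrite sum_fine; last by move=> v _; exact: fin_num_measure.
rewrite fsbig_seq ?index_enum_uniq // -measure_fin_bigcup //.
- congr (fine (Pr _)); rewrite -setI_bigcupr [X in _ = _ `&` X](_ : _ = setT) ?setIT//.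
  by rewrite -subTset => w _; exists (Y w) => //=; rewrite mem_index_enum.
- by move=> v v' _ _ [w [[_ <-] [_ <-]]].
Qed.

Lemma mutual_info_eq0 (U V : finType) (X : Om -> U) (Y : Om -> V) :
    (forall u v, rv_pmf Pr (rv_pair X Y) (u, v) = rv_pmf Pr X u * rv_pmf Pr Y v) ->
  mutual_info Pr X Y = 0.
Proof.
move=> indepXY; apply: big1 => u _; apply: big1 => v _; rewrite indepXY.
by have [->|nz] := eqVneq (rv_pmf Pr X u * rv_pmf Pr Y v) 0;
  rewrite ?mul0r// divff// ln1 mulr0.
Qed.

(** Each joint event is either empty or equal to the event [Y = v], so every term has a factor 0 or
    [ln 1]. *)
Lemma cond_entropy_eq0 (U V : finType) (X : Om -> U) (Y : Om -> V) :
    (forall w w', Y w = Y w' -> X w = X w') -> cond_entropy Pr X Y = 0.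
Proof.
move=> XofY; apply/eqP; rewrite oppr_eq0; apply/eqP.
apply: big1 => u _; apply: big1 => v _.
have [[w0 [Xw0 Yw0]]|no_w] := pselect (exists w, X w = u /\ Y w = v).
  have -> : rv_pmf Pr (rv_pair X Y) (u, v) = rv_pmf Pr Y v.
    congr (fine (Pr _)); apply/seteqP; split=> w /=; first by case.
    by move=> Yw; rewrite /rv_pair Yw (XofY w w0) ?Xw0 // Yw Yw0.
  by have [->|nz] := eqVneq (rv_pmf Pr Y v) 0; rewrite ?mul0r// divff// ln1 mulr0.
suff -> : rv_pmf Pr (rv_pair X Y) (u, v) = 0 by rewrite mul0r.
rewrite /rv_pmf (_ : _ @^-1` _ = set0) ?measure0 //.
by rewrite -subset0 => w [Xw Yw]; apply: no_w; exists w.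
Qed.

(** For fixed data [v], injectivity and the cardinality bound make [g v] a bijection, so exactly one
    key yields a given [u]. The joint probability is then [c] times that of [v], whatever [u] is. *)
Lemma one_time_pad (U V W : finType) (X : Om -> U) (Y : Om -> V) (Z : Om -> W)
    (g : V -> W -> U) (c : R) :
    (forall w, X w = g (Y w) (Z w)) ->
    (forall v, injective (g v)) -> (#|U| <= #|W|)%N ->
    (forall v, measurable (Y @^-1` [set v])) ->
    (forall k, measurable (Z @^-1` [set k])) ->
    (forall k, rv_pmf Pr Z k = c) -> independent2 Pr Z Y ->
  mutual_info Pr X Y = 0.
Proof.
move=> XE g_inj leUW mY mZ Zc indepZY.
have joint u v : exists2 k, X @^-1` [set u] `&` Y @^-1` [set v] =
    Z @^-1` [set k] `&` Y @^-1` [set v] &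
    fine (Pr (X @^-1` [set u] `&` Y @^-1` [set v])) = c * rv_pmf Pr Y v.
  have [h gK hK] := inj_card_bij (g_inj v) leUW.
  suff eqE : X @^-1` [set u] `&` Y @^-1` [set v] =
    Z @^-1` [set (h u)] `&` Y @^-1` [set v].
    by exists (h u); rewrite // eqE indepZY -(Zc (h u)).
  apply/seteqP; split=> w /= [+ Yw]; rewrite XE Yw => gE; split=> //.
    by rewrite -gE gK.
  by rewrite gE hK.
(* Measurability of [X] is inherited from the key and the data through these joint events. *)
have mXY u v : measurable (X @^-1` [set u] `&` Y @^-1` [set v]).
  by have [k -> _] := joint u v; exact: measurableI.
have Y1 : \sum_v rv_pmf Pr Y v = 1.
  have := fine_prob_total (@measurableT _ Om) mY.
  rewrite probability_setT /= => ->.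
  by apply: eq_bigr => v _; rewrite setTI.
have mX u : measurable (X @^-1` [set u]).
  rewrite [X in measurable X](_ : _ = \bigcup_v (X @^-1` [set u] `&` Y @^-1` [set v])).
    exact: fin_bigcup_measurable.
  by apply/seteqP; split=> [w Xw|w [v _ []//]]; exists (Y w).
have Xc u : rv_pmf Pr X u = c.
  rewrite /rv_pmf (fine_prob_total (mX u) mY).
  transitivity (\sum_v c * rv_pmf Pr Y v); last by rewrite -mulr_sumr Y1 mulr1.
  by apply: eq_bigr => v _; have [_ _ ->] := joint u v.
apply: mutual_info_eq0 => u v; rewrite Xc.
have [_ _ <-] := joint u v; congr (fine (Pr _)).
by apply/seteqP; split=> w /=; rewrite /rv_pair => -[-> ->].
Qed.

Lemma measurable_preimage_pair (U V : finType) (X : Om -> U) (Y : Om -> V) :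
    (forall u, measurable (X @^-1` [set u])) ->
    (forall v, measurable (Y @^-1` [set v])) ->
  forall uv, measurable (rv_pair X Y @^-1` [set uv]).
Proof.
move=> mX mY [u v]; rewrite (_ : _ @^-1` _ = X @^-1` [set u] `&` Y @^-1` [set v]).
  exact: measurableI.
by apply/seteqP; split=> w /=; rewrite /rv_pair => -[-> ->].
Qed.

Lemma measurable_preimage_family (I V : finType) (X : I -> Om -> V) :
    (forall i v, measurable (X i @^-1` [set v])) ->
  forall f, measurable (rv_family X @^-1` [set f]).
Proof.
move=> mX f.
rewrite (_ : _ @^-1` _ = \bigcap_i (X i @^-1` [set f i])).
  exact: fin_bigcap_measurable.
apply/seteqP; split=> [w <- i _|w fE] /=; first by rewrite ffunE.
by apply/ffunP=> i; rewrite ffunE; apply: fE.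
Qed.

Lemma iid_uniform_mx_pmf (F : finFieldType) (m n : nat) (X : Om -> 'M[F]_(m, n))
    (M : 'M[F]_(m, n)) :
  iid_uniform_mx Pr X -> rv_pmf Pr X M = #|F|%:R ^- (m * n).
Proof.
case=> _ indepX unifX; rewrite /rv_pmf.
have := indepX [set: 'I_m * 'I_n]%SET
  (fun ij => (fun w => X w ij.1 ij.2) @^-1` [set M ij.1 ij.2]).
rewrite (_ : \bigcap_(i in _) _ = X @^-1` [set M]) => [->|].
- under eq_bigr => ij _ do rewrite -/(rv_pmf Pr (fun w => X w ij.1 ij.2) _) unifX.
  by rewrite big_const iter_mulr_1 cardsT card_prod !card_ord exprVn.
- by move=> ij _; exists [set M ij.1 ij.2].
apply/seteqP; split=> [w XM|w XM ij _] /=; last by rewrite XM.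
by apply/matrixP=> i j; apply: (XM (i, j)); rewrite /= inE.
Qed.

End Probability.

(** * Block partitions and block products *)

Section Blocks.

Lemma block_ord_bij (t T : nat) : (0 < t)%N -> (t %| T)%N ->
  bijective (fun iu : 'I_t * 'I_(T %/ t) => @block_ord t T iu.1 iu.2).
Proof.
move=> t_gt0 tT; apply: inj_card_bij; last first.
  by rewrite card_prod !card_ord mulnC divnK.
move=> [i u] [i' u'] /(congr1 val) /= eq_iu.
(* [T] may be 0; the block size is positive here because [u] inhabits its index type. *)
have q_gt0 : (0 < T %/ t)%N by apply: leq_ltn_trans (ltn_ord u).
have := congr1 (fun n => n %/ (T %/ t))%N eq_iu.
rewrite /= !divnMDl // !divn_small // !addn0 => eq_i.
move: eq_iu; rewrite eq_i => /addnI eq_u.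
by congr pair; apply: val_inj.
Qed.

Lemma mx_blockM (F : fieldType) (T S D t s d : nat)
    (A : 'M[F]_(T, S)) (B : 'M[F]_(S, D)) (i : 'I_t) (l : 'I_d) :
    (0 < s)%N -> (s %| S)%N ->
  mx_block (A *m B) i l = \sum_(j < s) mx_block A i j *m mx_block B j l.
Proof.
move=> s_gt0 sS; apply/matrixP=> u v; rewrite summxE mxE mxE.
rewrite (reindex _ (onW_bij _ (block_ord_bij s_gt0 sS))).
rewrite -(pair_bigA _ (fun j h => A (block_ord i u) (block_ord j h) *
                                  B (block_ord j h) (block_ord l v))) /=.
by apply: eq_bigr => j _; rewrite mxE; apply: eq_bigr => h _; rewrite !mxE.
Qed.

Lemma mx_block_inj (F : Type) (T D t d : nat) (M M' : 'M[F]_(T, D)) :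
    (0 < t)%N -> (0 < d)%N -> (t %| T)%N -> (d %| D)%N ->
    (forall (i : 'I_t) (l : 'I_d), mx_block M i l = mx_block M' i l) ->
  M = M'.
Proof.
move=> t_gt0 d_gt0 tT dD eqM; apply/matrixP=> a b.
have [f _ fK] := block_ord_bij t_gt0 tT.
have [h _ hK] := block_ord_bij d_gt0 dD.
have := congr1 (fun X : 'M[F]_(T %/ t, D %/ d) => X (f a).2 (h b).2)
               (eqM (f a).1 (h b).1).
by rewrite !mxE fK hK.
Qed.

End Blocks.

(** * Exponents of the encoding polynomials *)

Section Exponents.
Variables t s d PC : nat.
Hypotheses (t_gt0 : (0 < t)%N) (s_gt0 : (0 < s)%N) (d_gt0 : (0 < d)%N).

Definition expa (k : 'I_t * 'I_s + 'I_PC) : nat :=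
  match k with
  | inl ij => (ij.1 + t * ij.2)%N
  | inr r => (t * s + r)%N
  end.

Definition expb (k : 'I_s * 'I_d + 'I_PC) : nat :=
  match k with
  | inl kl => ((s - kl.1.+1) * t + t * sgpd_sstar t s d PC * kl.2)%N
  | inr r => (t * (sgpd_sstar t s d PC * d - sgpd_delta t d PC) + r)%N
  end.

Lemma leq_PC_delta : (PC <= t * sgpd_delta t d PC)%N.
Proof.
rewrite /sgpd_delta /ceil_div.
have m_gt0 : (0 < minn t d)%N by rewrite leq_min t_gt0.
apply: (@leq_trans (minn t d * ((PC + (minn t d).-1) %/ minn t d))); last first.
  by rewrite leq_mul2r geq_minl orbT.
have := divn_eq (PC + (minn t d).-1) (minn t d).
have := ltn_pmod (PC + (minn t d).-1) m_gt0.
by move: (_ %% _)%N (_ %/ _)%N => x y; lia.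
Qed.

(** The subtraction-free form shows that the masks of [B] start at exponent t s^* (d-1) + ts, above
    all its data exponents. *)
Lemma sstar_mul_subE : (sgpd_sstar t s d PC * d - sgpd_delta t d PC =
  sgpd_sstar t s d PC * d.-1 + s)%N.
Proof.
have sstE : sgpd_sstar t s d PC = (s + sgpd_delta t d PC)%N by [].
rewrite -[X in (_ * X - _)%N](prednK d_gt0) mulnS.
by move: (_ * d.-1)%N => x; lia.
Qed.

Lemma expa_lt k : (expa k < t * s + PC)%N.
Proof.
case: k => [[i j]|r] /=; last by rewrite ltn_add2l.
by have := ltn_ord i; have := ltn_ord j; nia.
Qed.

Lemma expb_lt k :
  (expb k < t * (sgpd_sstar t s d PC * d - sgpd_delta t d PC) + PC)%N.
Proof.
rewrite /expb sstar_mul_subE; case: k => [[k l]|r] /=; last by rewrite ltn_add2l.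
have lek : ((s - k.+1) * t + t <= t * s)%N by have := ltn_ord k; nia.
have lel : (t * sgpd_sstar t s d PC * l <= t * (sgpd_sstar t s d PC * d.-1))%N.
  by rewrite -mulnA !leq_mul //; have := ltn_ord l; lia.
by rewrite mulnDr; lia.
Qed.

Lemma exp_lt k1 k2 : (expa k1 + expb k2 < sgpd_threshold t s d PC)%N.
Proof. by have := expa_lt k1; have := expb_lt k2; rewrite /sgpd_threshold; lia. Qed.

Lemma radix_inj (n a b x y : nat) : (a < n)%N -> (b < n)%N ->
  (a + n * x = b + n * y)%N -> a = b /\ x = y.
Proof.
move=> an bn eq_ab; have n_gt0 : (0 < n)%N by apply: leq_ltn_trans an.
have := congr1 (fun c => c %% n)%N eq_ab; have := congr1 (fun c => c %/ n)%N eq_ab.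
by rewrite /= ![(_ + n * _)%N]addnC ![(n * _)%N]mulnC !divnMDl // !modnMDl
  !modn_small // !divn_small // !addn0.
Qed.

Lemma exp_alignedP (i : 'I_t) (l : 'I_d) k1 k2 :
    (expa k1 + expb k2 = i + t * (s - 1) + t * sgpd_sstar t s d PC * l)%N ->
  exists j : 'I_s, k1 = inl (i, j) /\ k2 = inl (j, l).
Proof.
have ltit := ltn_ord i.
have leP := leq_PC_delta.
case: k2 => [[k l']|r']; last first.
  (* A mask of [B] has exponent at least t s^* (d-1) + ts, whereas i + t (s-1) < ts and l <= d-1
     keep the target below this. *)
  rewrite /expb sstar_mul_subE => eq_e; exfalso.
  have lel : (t * sgpd_sstar t s d PC * l <= t * (sgpd_sstar t s d PC * d.-1))%N.
    by rewrite -mulnA !leq_mul //; have := ltn_ord l; lia.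
  have ts : (t * (s - 1) + t = t * s)%N by nia.
  by move: eq_e; rewrite mulnDr; lia.
have ltks := ltn_ord k.
case: k1 => [[i' j]|r] /= eq_e; last first.
  exfalso; have ltr := ltn_ord r.
  have ts : (t * (s - 1) + t = t * s)%N by nia.
  have lek : ((s - k.+1) * t + t <= t * s)%N by nia.
  (* For a mask of [A] times a data block of [B]: if l <= l', the term ts alone overshoots i + t
     (s-1). If l' < l, then r < PC <= t Delta keeps the exponent below t s^* (l'+1) + t (s-1), hence
     below the target. *)
  have [lell'|ltl'l] := leqP l l'.
    have : (t * sgpd_sstar t s d PC * l <= t * sgpd_sstar t s d PC * l')%N.
      by rewrite leq_mul.
    move: eq_e ts lek.
    by move: (t * (s - 1))%N (_ * t)%N (t * s)%N (_ * l)%N (_ * l')%N; lia.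
  have : (t * sgpd_sstar t s d PC * l'.+1 <= t * sgpd_sstar t s d PC * l)%N.
    by rewrite leq_mul.
  have -> : (t * sgpd_sstar t s d PC * l'.+1 =
    t * sgpd_sstar t s d PC * l' + t * s + t * sgpd_delta t d PC)%N.
    by rewrite /sgpd_sstar; ring.
  move: eq_e ts lek leP.
  by move: (t * (s - 1))%N (_ * t)%N (t * s)%N (_ * l)%N (_ * l')%N (t * _)%N; lia.
have ltjs := ltn_ord j.
(* Data times data: the lowest digit in base t gives the row block. *)
have [eq_i eq_j] : val i' = val i /\
    (j + (s - k.+1) + sgpd_sstar t s d PC * l' =
     s - 1 + sgpd_sstar t s d PC * l)%N.
  apply: (@radix_inj t); [exact: ltn_ord | exact: ltn_ord |].
  rewrite /= !mulnDr !mulnA.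
  by move: eq_e; rewrite [((s - _) * t)%N]mulnC; lia.
(* Moving k across gives j + s^* l' = k + s^* l, with both j and k below s <= s^*. *)
have [eq_jk eq_l] : val j = val k /\ val l' = val l.
  apply: (@radix_inj (sgpd_sstar t s d PC)); [exact: ltn_addr | exact: ltn_addr |].
  by move: eq_j; rewrite /=; lia.
by exists j; rewrite (val_inj eq_i) (val_inj eq_jk) (val_inj eq_l).
Qed.

End Exponents.

(** * Recovering the blocks of the product from the worker outputs *)

Section Decoding.
Variables (F : finFieldType) (T S D t s d PC : nat).
Hypotheses (t_gt0 : (0 < t)%N) (s_gt0 : (0 < s)%N) (d_gt0 : (0 < d)%N).
Hypotheses (tT : (t %| T)%N) (sS : (s %| S)%N) (dD : (d %| D)%N).

Definition coefs_a (A : 'M[F]_(T, S)) (Ra : 'I_PC -> 'M[F]_(T %/ t, S %/ s))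
    (k : 'I_t * 'I_s + 'I_PC) : 'M[F]_(T %/ t, S %/ s) :=
  match k with inl ij => mx_block A ij.1 ij.2 | inr r => Ra r end.

Definition coefs_b (B : 'M[F]_(S, D)) (Rb : 'I_PC -> 'M[F]_(S %/ s, D %/ d))
    (k : 'I_s * 'I_d + 'I_PC) : 'M[F]_(S %/ s, D %/ d) :=
  match k with inl kl => mx_block B kl.1 kl.2 | inr r => Rb r end.

Lemma sgpd_mulE (A : 'M[F]_(T, S)) (Ra : 'I_PC -> 'M[F]_(T %/ t, S %/ s))
    (B : 'M[F]_(S, D)) (Rb : 'I_PC -> 'M[F]_(S %/ s, D %/ d)) (x : F) :
  sgpd_Fa A Ra x *m sgpd_Fb t B Rb x =
  \sum_(k : ('I_t * 'I_s + 'I_PC) * ('I_s * 'I_d + 'I_PC))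
     x ^+ (expa k.1 + expb t k.2) *: (coefs_a A Ra k.1 *m coefs_b B Rb k.2).
Proof.
have -> : sgpd_Fa A Ra x = \sum_k x ^+ expa k *: coefs_a A Ra k.
  by rewrite big_sumType /= /sgpd_Fa pair_bigA.
have -> : sgpd_Fb t B Rb x = \sum_k x ^+ expb t k *: coefs_b B Rb k.
  by rewrite big_sumType /= /sgpd_Fb pair_bigA.
rewrite mulmx_suml; under eq_bigr do rewrite mulmx_sumr.
rewrite pair_bigA; apply: eq_bigr => k _.
by rewrite -scalemxAl -scalemxAr scalerA exprD.
Qed.

(** By [exp_alignedP] the pairs summed over are those of A_(i,j) and B_(j,l), one for each j, which
    is the block product formula. *)
Lemma sgpd_coef_aligned (A : 'M[F]_(T, S))
    (Ra : 'I_PC -> 'M[F]_(T %/ t, S %/ s)) (B : 'M[F]_(S, D))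
    (Rb : 'I_PC -> 'M[F]_(S %/ s, D %/ d)) (i : 'I_t) (l : 'I_d) :
  \sum_(k : ('I_t * 'I_s + 'I_PC) * ('I_s * 'I_d + 'I_PC) |
         (expa k.1 + expb t k.2 ==
          i + t * (s - 1) + t * sgpd_sstar t s d PC * l)%N)
     coefs_a A Ra k.1 *m coefs_b B Rb k.2 = mx_block (A *m B) i l.
Proof.
pose inj (j : 'I_s) : ('I_t * 'I_s + 'I_PC) * ('I_s * 'I_d + 'I_PC) :=
  (inl (i, j), inl (j, l)).
(* The value on masks is arbitrary, since no mask occurs at this exponent. *)
pose prj (k : ('I_t * 'I_s + 'I_PC) * ('I_s * 'I_d + 'I_PC)) : 'I_s :=
  if k.1 is inl ij then ij.2 else Ordinal s_gt0.
rewrite (reindex_onto inj prj); last first.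
  by move=> [k1 k2] /eqP /(exp_alignedP t_gt0 s_gt0 d_gt0) [j /= [-> ->]].
rewrite (mx_blockM _ _ _ _ s_gt0 sS); apply: eq_bigl => j.
rewrite eqxx andbT; apply/eqP => /=.
have -> : (s - 1 = j + (s - j.+1))%N by have := ltn_ord j; lia.
by rewrite mulnDr [((s - _) * t)%N]mulnC !addnA.
Qed.

(** Comparing two realisations, masks included, expresses that the outputs determine the product
    without naming a decoder. *)
Lemma sgpd_decoding (N : nat) (z : 'I_N -> F) (P : {set 'I_N})
    (A A' : 'M[F]_(T, S)) (Ra Ra' : 'I_PC -> 'M[F]_(T %/ t, S %/ s))
    (B B' : 'M[F]_(S, D)) (Rb Rb' : 'I_PC -> 'M[F]_(S %/ s, D %/ d)) :
    injective z -> #|P| = sgpd_threshold t s d PC ->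
    (forall p, p \in P ->
       sgpd_Fa A Ra (z p) *m sgpd_Fb t B Rb (z p) =
       sgpd_Fa A' Ra' (z p) *m sgpd_Fb t B' Rb' (z p)) ->
  A *m B = A' *m B'.
Proof.
move=> z_inj cardP eqC; apply: (mx_block_inj t_gt0 d_gt0 tT dD) => i l.
rewrite -(sgpd_coef_aligned A Ra B Rb) -(sgpd_coef_aligned A' Ra' B' Rb').
apply: (coef_sum_eq z_inj (P := P)) => [k|p pP].
  by rewrite cardP; exact: exp_lt.
by rewrite -!sgpd_mulE; exact: eqC.
Qed.

End Decoding.

(** * Law of the masks and the three requirements *)

Lemma uniform_masks_pmf (R : realType) (disp : measure_display)
    (Om : measurableType disp) (Pr : probability Om R) (F : finFieldType)
    (I J : finType) (m k n : nat)
    (Ra : I -> Om -> 'M[F]_(m, k)) (Rb : J -> Om -> 'M[F]_(k, n)) :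
    (forall r, iid_uniform_mx Pr (Ra r)) ->
    (forall r, iid_uniform_mx Pr (Rb r)) ->
    mutually_independent Pr (fun i : I + J =>
       match i with
       | inl r => rv_events (Ra r)
       | inr r => rv_events (Rb r)
       end) ->
  exists c, forall q, rv_pmf Pr (rv_pair (rv_family Ra) (rv_family Rb)) q = c.
Proof.
move=> iidRa iidRb indepR.
exists (\prod_(i : I + J)
  if i is inl _ then #|F|%:R ^- (m * k) else #|F|%:R ^- (k * n)) => -[qa qb].
pose E (i : I + J) := match i with
  | inl r => Ra r @^-1` [set qa r]
  | inr r => Rb r @^-1` [set qb r]
  end.
transitivity (fine (Pr (\bigcap_(i in [set` [set: I + J]%SET]) E i))).
  congr (fine (Pr _)); apply/seteqP; split=> w /=.
    by case=> eqa eqb [] r _ /=; rewrite -?eqa -?eqb ffunE.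
  move=> Ew; congr pair; apply/ffunP => r; rewrite ffunE.
    by apply: (Ew (inl r)); rewrite /= inE.
  by apply: (Ew (inr r)); rewrite /= inE.
rewrite indepR => [|[] r _]; last 2 first.
- by exists [set qa r].
- by exists [set qb r].
apply: eq_big => [i|[] r _]; first by rewrite inE.
- exact: iid_uniform_mx_pmf (iidRa r).
- exact: iid_uniform_mx_pmf (iidRb r).
Qed.

Theorem theorem2 (R : realType) (disp : measure_display)
    (Om : measurableType disp) (Pr : probability Om R)
    (F : finFieldType) (N T S D t s d PC : nat) (z : 'I_N -> F)
    (A : Om -> 'M[F]_(T, S)) (B : Om -> 'M[F]_(S, D))
    (Ra : 'I_PC -> Om -> 'M[F]_(T %/ t, S %/ s))
    (Rb : 'I_PC -> Om -> 'M[F]_(S %/ s, D %/ d))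
    (t_gt0 : (0 < t)%N) (s_gt0 : (0 < s)%N) (d_gt0 : (0 < d)%N)
    (le_ts : (t <= s)%N)
    (tT : (t %| T)%N) (sS : (s %| S)%N) (dD : (d %| D)%N)
    (ltNF : (N < #|F|)%N) (ltPCN : (PC < N)%N)
    (lePRN : (sgpd_threshold t s d PC <= N)%N)
    (z_inj : injective z) (z_neq0 : forall p, z p != 0)
    (iidA : iid_uniform_mx Pr A) (iidB : iid_uniform_mx Pr B)
    (indepAB : independent2 Pr A B)
    (iidRa : forall r, iid_uniform_mx Pr (Ra r))
    (iidRb : forall r, iid_uniform_mx Pr (Rb r))
    (indepR : mutually_independent Pr (fun i : 'I_PC + 'I_PC =>
       match i with
       | inl r => rv_events (Ra r)
       | inr r => rv_events (Rb r)
       end))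
    (indepR_AB : independent2 Pr
       (rv_pair (rv_family Ra) (rv_family Rb)) (rv_pair A B)) :
  [/\ secure Pr A B (sgpd_encA z A Ra) (sgpd_encB t z B Rb) PC,
      decodable Pr A B (sgpd_out z A B Ra Rb) (sgpd_threshold t s d PC) &
      forall (P : {set 'I_N}) (w : Om), #|P| = sgpd_threshold t s d PC ->
        (comm_load P (fun p => sgpd_out z A B Ra Rb p w))%:R =
        (sgpd_threshold t s d PC)%:R * ((T * D)%:R / (t * d)%:R) :> rat].
Proof.
split.
- move=> P cardP.
  have [c Rc] := uniform_masks_pmf iidRa iidRb indepR.
  pose g (v : 'M[F]_(T, S) * 'M[F]_(S, D))
      (k : {ffun 'I_PC -> 'M[F]_(T %/ t, S %/ s)} *
           {ffun 'I_PC -> 'M[F]_(S %/ s, D %/ d)}) :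
      {ffun {p : 'I_N | p \in P} -> 'M[F]_(T %/ t, S %/ s)} *
      {ffun {p : 'I_N | p \in P} -> 'M[F]_(S %/ s, D %/ d)} :=
    ([ffun p => sgpd_Fa v.1 k.1 (z (val p))],
     [ffun p => sgpd_Fb t v.2 k.2 (z (val p))]).
  (* The masks act as the key, (A, B) as the data and the colluding shares as the ciphertext. *)
  apply: (one_time_pad (g := g) _ _ _ _ _ Rc indepR_AB).
  + move=> w; congr pair; apply/ffunP=> p; rewrite !ffunE.
      by rewrite /sgpd_encA; congr sgpd_Fa; apply/funext=> r; rewrite ffunE.
    by rewrite /sgpd_encB; congr sgpd_Fb; apply/funext=> r; rewrite ffunE.
  + move=> [a b] [qa qb] [qa' qb'] [/ffunP eqa /ffunP eqb].
    congr pair; apply/ffunP; apply: (masks_inj z_inj z_neq0 cardP) => p pP.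
      (* The data part is common to both sides and cancels, leaving the mask sums. *)
      by move: (eqa (exist _ p pP)); rewrite !ffunE => /addrI; exact: id.
    by move: (eqb (exist _ p pP)); rewrite !ffunE => /addrI; exact: id.
  (* Since [#|P| = PC], there are as many share tuples as mask tuples. *)
  + by rewrite !card_prod !card_ffun card_sig card_ord cardP.
  + apply: measurable_preimage_pair => v.
      by have [mA _ _] := iidA; exact: mA.
    by have [mB _ _] := iidB; exact: mB.
  + apply: measurable_preimage_pair; apply: measurable_preimage_family => r v.
      by have [mR _ _] := iidRa r; exact: mR.
    by have [mR _ _] := iidRb r; exact: mR.
- move=> P cardP; apply: cond_entropy_eq0 => w w' /ffunP eqC.
  apply: (sgpd_decoding t_gt0 s_gt0 d_gt0 tT sS dD z_inj cardP) => p pP.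
  by have := eqC (exist _ p pP); rewrite !ffunE; apply.
- move=> P w cardP; rewrite /comm_load /num_entries.
  rewrite sum_nat_const card_prod !card_ord cardP natrM; congr (_ * _).
  have t0 : t%:R != 0 :> rat by rewrite pnatr_eq0 -lt0n.
  have d0 : d%:R != 0 :> rat by rewrite pnatr_eq0 -lt0n.
  (* Only the [T] and [D] outside the quotients are expanded, which turns the goal into a field
     identity. *)
  rewrite -{2}(divnK tT) -{2}(divnK dD) !natrM; field.
  by rewrite t0 d0.
Qed.
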